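(* Let $a \in C^{1}([0,\infty))$ satisfy $a(t)>0$ for all $t\ge 0$, $\sup\{a(t) : t\ge 0\}<+\infty$, and $a'(t)\ge 0$ for all $t\ge 0$. Let $u_0,u_1\in C_0^\infty(\mathbf{R})$, set $v_1(x):=\int_{-\infty}^{x}u_1(y)\,dy$, and assume $v_1\in L^2(\mathbf{R})$. Let $u$ be the solution of the Cauchy problem $$u_{tt}(t,x)-a(t)^2u_{xx}(t,x)=0,\quad (t,x)\in(0,\infty)\times\mathbf{R},\qquad u(0,x)=u_0(x),\quad u_t(0,x)=u_1(x),\quad x\in\mathbf{R}.$$ Then $$\|u(t,\cdot)\|^2\le I_0^2\,a(0)^{-2}\qquad\text{for all } t\ge 0,$$ where $I_0:=\left(\|v_1\|^2+a(0)^2\|u_0\|^2\right)^{1/2}$.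
   Context: $\|\cdot\|$ denotes the usual $L^2(\mathbf{R})$-norm, and $C_0^\infty(\mathbf{R})$ is the space of smooth compactly supported functions on $\mathbf{R}$. The solution $u$ is the unique strong solution in the class $C([0,\infty);H^2(\mathbf{R}))\cap C^1([0,\infty);H^1(\mathbf{R}))\cap C^2([0,\infty);L^2(\mathbf{R}))$; its existence, its uniqueness and its finite speed of propagation (with propagation speed $a_m:=\sup\{a(t):t\ge 0\}$) are known facts. *)

(* Defs.v *)
From mathcomp Require Import all_boot all_order all_algebra.
From mathcomp Require Import all_classical all_reals all_analysis.
Set Implicit Arguments.
Unset Strict Implicit.
Unset Printing Implicit Defensive.
Import Order.TTheory GRing.Theory Num.Theory.
Import numFieldNormedType.Exports.
Local Open Scope classical_set_scope.
Local Open Scope ring_scope.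

Definition test_function (R : realType) (f : R -> R) : Prop :=
  (forall (n : nat) (x : R), derivable (f^`(n))%classic x 1) /\
  compact (closure [set x | f x != 0]).

(* Elements of L^2 and of the Sobolev spaces are represented by Borel
   functions; equality in these spaces is equality almost everywhere. *)
Definition L2 (R : realType) : set (R -> R) :=
  [set f | f \in Lfun (@lebesgue_measure R) 2%:E].

(* [fine] sends +oo to 0, so this is only meaningful on [L2 R]. *)
Definition L2norm (R : realType) (f : R -> R) : R :=
  fine ('N[@lebesgue_measure R]_2%:E [EFin \o f])%E.

Definition weak_derivative (R : realType) (k : nat) (f g : R -> R) : Prop :=
  forall phi : R -> R, test_function phi ->
    Rintegral (@lebesgue_measure R) setT (fun x => f x * (phi^`(k))%classic x) =
    (-1) ^+ k * Rintegral (@lebesgue_measure R) setT (fun x => g x * phi x).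

Definition Hsp (R : realType) (k : nat) : set (R -> R) :=
  [set f | L2 f /\
    forall j : nat, (j <= k)%N -> exists g, L2 g /\ weak_derivative j f g].

(* The weak derivative of order [k] in L^2, unique up to a.e. equality; it is
   the zero function when there is none. *)
Definition wderiv (R : realType) (k : nat) (f : R -> R) : R -> R :=
  xget (fun=> 0) [set g | L2 g /\ weak_derivative k f g].

Definition Hnorm (R : realType) (k : nat) (f : R -> R) : R :=
  Num.sqrt (\sum_(j < k.+1) L2norm (wderiv j f) ^+ 2).

(* Curves [0,oo) -> X, where X is a space of functions with norm N.  A curve
   is a total function of time whose values at negative times are ignored. *)
Definition curve_continuous (R : realType) (X : set (R -> R))
    (N : (R -> R) -> R) (U : R -> R -> R) : Prop :=
  forall t : R, 0 <= t -> X (U t) /\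
    N (fun x => U s x - U t x) @[s --> within `[0, +oo[ (nbhs t)] --> 0.

(* V is the derivative of U in the norm N, one-sided at t = 0. *)
Definition curve_derivative (R : realType) (X : set (R -> R))
    (N : (R -> R) -> R) (U V : R -> R -> R) : Prop :=
  forall t : R, 0 <= t -> [/\ X (U t), X (V t) &
    N (fun x => (s - t)^-1 * (U s x - U t x) - V t x)
      @[s --> within `[0, +oo[ t^'] --> 0].

Fixpoint curve_C (R : realType) (n : nat) (X : set (R -> R))
    (N : (R -> R) -> R) (U : R -> R -> R) : Prop :=
  match n with
  | 0%N => curve_continuous X N U
  | m.+1 => curve_continuous X N U /\
      exists V, curve_derivative X N U V /\ curve_C m X N V
  end.

Definition strong_solution (R : realType) (a u0 u1 : R -> R)
    (u : R -> R -> R) : Prop :=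
  [/\ curve_C 0 (@Hsp R 2) (@Hnorm R 2) u,
      curve_C 1 (@Hsp R 1) (@Hnorm R 1) u,
      curve_C 2 (@L2 R) (@L2norm R) u &
      exists ut utt : R -> R -> R,
        [/\ curve_derivative (@L2 R) (@L2norm R) u ut,
            curve_derivative (@L2 R) (@L2norm R) ut utt,
            forall t : R, 0 < t -> {ae @lebesgue_measure R, forall x,
              utt t x - a t ^+ 2 * wderiv 2 (u t) x = 0},
            {ae @lebesgue_measure R, forall x, u 0 x = u0 x} &
            {ae @lebesgue_measure R, forall x, ut 0 x = u1 x}]].

Definition halfline_quotient (R : realType) (a : R -> R) (t s : R) : R :=
  (s - t)^-1 * (a s - a t).

(* Derivative of a function on [0,oo), one-sided at 0. *)
Definition halfline_derive (R : realType) (a : R -> R) (t : R) : R :=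
  lim (halfline_quotient a t s @[s --> within `[0, +oo[ t^']).

Definition halfline_C1 (R : realType) (a : R -> R) : Prop :=
  (forall t : R, 0 <= t ->
     cvg (halfline_quotient a t s @[s --> within `[0, +oo[ t^'])) /\
  {within `[0, +oo[, continuous (halfline_derive a)}.

Definition primitive (R : realType) (f : R -> R) (x : R) : R :=
  Rintegral (@lebesgue_measure R) `]-oo, x] f.

Definition I0 (R : realType) (a u0 u1 : R -> R) : R :=
  Num.sqrt (L2norm (primitive u1) ^+ 2 + a 0 ^+ 2 * L2norm u0 ^+ 2).

(* Main.v *)
Require Import Defs.
From mathcomp Require Import all_boot all_order all_algebra.
From mathcomp Require Import all_classical all_reals all_analysis.
From mathcomp Require Import measurable_realfun ring lra.
Import Order.TTheory GRing.Theory Num.Theory.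
Import numFieldNormedType.Exports.
Set Implicit Arguments.
Unset Strict Implicit.
Unset Printing Implicit Defensive.
Local Open Scope classical_set_scope.
Local Open Scope ring_scope.

(** Formally, the antiderivative w of u in x solves the same wave equation, with
    w_x = u and w_t(0) = v1, and its energy ||w_t||^2 / a^2 + ||w_x||^2 has
    derivative - 2 a' ||w_t||^2 / a^3 <= 0.  Comparing the energies at times t
    and 0 gives ||u(t)||^2 <= ||v1||^2 / a(0)^2 + ||u0||^2, which is the claim.

    To keep every quantity in L^2 without knowing that w or w_t is square
    integrable at positive times, the argument is run on the symmetric
    difference w(x + h) - w(x - h), which is S u for the bounded self-adjoint
    operator S f (x) = int_(x-h)^(x+h) f ([window]).  Writing D for the
    skew-adjoint operator D f (x) = f(x + h) - f(x - h) ([sdiff]), one has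
    (S f)' = D f, and the energy becomes
    E_h = ||S u_t||^2 / a^2 + ||D u||^2.

    - E_h is non-increasing ([energy_nonincreasing]).  The two terms in which
      a' does not appear cancel because <S u_xx, S f> = - <D u, D f> for every f
      in L^2 ([weak_derivative2_window]).  Since S and D are bounded, the L^2
      derivatives of u and u_t suffice to differentiate E_h
      ([curve_derivative_dot]).

    - The identity <S g, S f> = - <D u, D f>, where g is the weak second
      derivative of u, means S S g = D D u.  For a test function phi, S S phi is
      a test function with second derivative D D phi, so that the definition of
      g makes S S g - D D u orthogonal to all test functions, hence zero almost
      everywhere ([orthogonal_test_ae]).

    - As h tends to infinity the translates f(x + h) and f(x - h) become
      orthogonal, so ||D f||^2 tends to 2 ||f||^2 ([sdiff_norm_cvg]).  As
      S u1 = D v1, the inequality E_h(t) >= ||D u(t)||^2 turns E_h(t) <= E_h(0)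
      into twice the claim. *)

(** * The inner product of square-integrable functions *)

Section inner_product.
Context {R : realType}.
Local Notation mu := (@lebesgue_measure R).
Implicit Types (f g h : R -> R) (c : R).

Definition dot f g : R := \int[mu]_x (f x * g x).

(** Square integrability in elementary terms, so that closure properties reduce
    to integrability of sums and products. *)
Lemma L2P f : L2 f <->
  measurable_fun setT f /\ mu.-integrable setT (EFin \o (fun x => f x ^+ 2)).
Proof.
split=> [fL|[mf /integrableP[_ foo]]].
  split; last exact: Lfun2_integrable_sqr.
  by move: fL; rewrite /L2 /= inE => /andP[+ _]; rewrite inE.
rewrite /L2 /= inE; apply/andP; split; rewrite inE//=.
rewrite /finite_norm /= unlock; apply: poweR_lty.
apply: le_lt_trans foo; rewrite le_eqVlt; apply/orP; left; apply/eqP.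
apply: eq_integral => x _ /=.
by rewrite powR_mulrn// -normrX.
Qed.

Lemma L2_measurable f : L2 f -> measurable_fun setT f.
Proof. by case/L2P. Qed.

Lemma L2_sqr_integrable f :
  L2 f -> mu.-integrable setT (EFin \o (fun x => f x ^+ 2)).
Proof. by case/L2P. Qed.

Lemma L2_mul_integrable f g : L2 f -> L2 g ->
  mu.-integrable setT (EFin \o (fun x => f x * g x)).
Proof. by move=> fL gL; apply/Lfun1_integrable/Lfun2_mul_Lfun1. Qed.

Lemma L2_le f g : measurable_fun setT f -> L2 g ->
  (forall x, `|f x| <= `|g x|) -> L2 f.
Proof.
move=> mf gL fg; apply/L2P; split=> //.
apply: (le_integrable _ _ _ (L2_sqr_integrable gL)) => //.
  exact/measurable_EFinP/measurable_funX.
by move=> x _ /=; rewrite lee_fin !normrX lerXn2r ?nnegrE.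
Qed.

Lemma L2_scale c f : L2 f -> L2 (fun x => c * f x).
Proof.
move=> fL; apply/L2P; split.
  by apply: measurable_funM => //; exact: L2_measurable.
have := integrableZl measurableT (c ^+ 2) (L2_sqr_integrable fL).
apply: eq_integrable => // x _ /=; by rewrite -EFinM exprMn.
Qed.

Lemma L2_add f g : L2 f -> L2 g -> L2 (fun x => f x + g x).
Proof.
move=> fL gL; apply/L2P; split.
  by apply: measurable_funD; exact: L2_measurable.
have int2 := integrableZl measurableT 2 (L2_mul_integrable fL gL).
have := integrableD measurableT (L2_sqr_integrable fL)
  (integrableD measurableT int2 (L2_sqr_integrable gL)).
apply: eq_integrable => // x _ /=; rewrite -EFinM -!EFinD; congr EFin; ring.
Qed.

Lemma L2_sub f g : L2 f -> L2 g -> L2 (fun x => f x - g x).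
Proof.
move=> fL gL.
have := L2_add fL (L2_scale (-1) gL); congr L2.
by apply/funext => x; rewrite mulN1r.
Qed.

Lemma dotC f g : dot f g = dot g f.
Proof. by apply: eq_Rintegral => x _; rewrite mulrC. Qed.

Lemma dotDl f g h : L2 f -> L2 g -> L2 h ->
  dot (fun x => f x + g x) h = dot f h + dot g h.
Proof.
move=> fL gL hL; rewrite /dot.
under eq_Rintegral do rewrite mulrDl.
by rewrite RintegralD//; exact: L2_mul_integrable.
Qed.

Lemma dotZl c f h : L2 f -> L2 h -> dot (fun x => c * f x) h = c * dot f h.
Proof.
move=> fL hL; rewrite /dot.
under eq_Rintegral do rewrite -mulrA.
by rewrite RintegralZl//; exact: L2_mul_integrable.
Qed.

Lemma dotBl f g h : L2 f -> L2 g -> L2 h ->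
  dot (fun x => f x - g x) h = dot f h - dot g h.
Proof.
move=> fL gL hL; rewrite /dot.
under eq_Rintegral do rewrite mulrBl.
by rewrite RintegralB//; exact: L2_mul_integrable.
Qed.

Lemma dotDr f g h : L2 f -> L2 g -> L2 h ->
  dot f (fun x => g x + h x) = dot f g + dot f h.
Proof. by move=> *; rewrite dotC dotDl// !(dotC f). Qed.

Lemma dotBr f g h : L2 f -> L2 g -> L2 h ->
  dot f (fun x => g x - h x) = dot f g - dot f h.
Proof. by move=> *; rewrite dotC dotBl// !(dotC f). Qed.

Lemma dotZr c f h : L2 f -> L2 h -> dot f (fun x => c * h x) = c * dot f h.
Proof. by move=> *; rewrite dotC dotZl// dotC. Qed.

Lemma dot_ge0 f : 0 <= dot f f.
Proof. by apply: Rintegral_ge0 => x _; rewrite -expr2 sqr_ge0. Qed.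

Lemma L2norm_sqr f : L2 f -> L2norm f ^+ 2 = dot f f.
Proof.
move=> fL; rewrite /dot /Rintegral.
under eq_integral do rewrite -expr2.
have -> : (\int[mu]_x ((f x) ^+ 2)%:E = 'N[mu]_2%:E[EFin \o f] `^ 2)%E.
  rewrite poweR_Lnorm//; apply: eq_integral => x _ /=.
  by rewrite powR_mulrn// -normrX ger0_norm ?sqr_ge0.
rewrite fine_poweR /L2norm powR_mulrn// fine_ge0//; exact: Lnorm_ge0.
Qed.

Lemma L2norm_ge0 f : 0 <= L2norm f.
Proof. by rewrite fine_ge0// Lnorm_ge0. Qed.

Lemma L2normE f : L2 f -> L2norm f = Num.sqrt (dot f f).
Proof. by move=> fL; rewrite -L2norm_sqr// sqrtr_sqr ger0_norm// L2norm_ge0. Qed.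

Lemma cauchy_schwarz f g : L2 f -> L2 g -> `|dot f g| <= L2norm f * L2norm g.
Proof.
move=> fL gL.
rewrite -ler_sqr ?nnegrE ?mulr_ge0 ?L2norm_ge0//.
rewrite exprMn !L2norm_sqr// real_normK ?num_real//.
set A := dot f f; set B := dot f g; set C := dot g g.
have quad s t : 0 <= s ^+ 2 * A + 2 * s * t * B + t ^+ 2 * C.
  have -> : s ^+ 2 * A + 2 * s * t * B + t ^+ 2 * C =
    dot (fun x => s * f x + t * g x) (fun x => s * f x + t * g x).
    rewrite dotDl ?dotDr ?dotZl ?dotZr//; do ?[exact: L2_scale|apply: L2_add].
    by rewrite (dotC g f) -/A -/B -/C; ring.
  exact: dot_ge0.
have A0 : 0 <= A by exact: dot_ge0.
have C0 : 0 <= C by exact: dot_ge0.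
have [C00|Cn0] := eqVneq C 0.
  (* With C = 0 the form is s^2 A + 2 s t B; this choice of (s, t) gives
     - (A + 2) B^2, which forces B = 0 whether or not A vanishes. *)
  have := quad B (- (A + 1)); rewrite C00 !mulr0 addr0.
  have -> : B ^+ 2 * A + 2 * B * - (A + 1) * B = - ((A + 2) * B ^+ 2) by ring.
  by rewrite oppr_ge0 pmulr_rle0// ltr_wpDl.
have Cp : 0 < C by rewrite lt_def Cn0.
(* The minimizer of the quadratic form, up to scaling. *)
have := quad C (- B).
have -> : C ^+ 2 * A + 2 * C * - B * B + (- B) ^+ 2 * C = C * (A * C - B ^+ 2).
  by ring.
by rewrite pmulr_rge0// subr_ge0.
Qed.

Lemma L2norm_add f g : L2 f -> L2 g ->
  L2norm (fun x => f x + g x) <= L2norm f + L2norm g.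
Proof.
move=> fL gL; rewrite -ler_sqr ?nnegrE ?addr_ge0 ?L2norm_ge0//.
rewrite sqrrD !L2norm_sqr ?dotDl ?dotDr ?(dotC g f)//; try exact: L2_add.
have := cauchy_schwarz fL gL; have := ler_norm (dot f g).
move=> /le_trans /[apply]; lra.
Qed.

End inner_product.

(** * Translations and symmetric differences *)

Section translation.
Context {R : realType}.
Local Notation mu := (@lebesgue_measure R).
Implicit Types (f g : R -> R) (h s : R).

Lemma measurable_shift f s :
  measurable_fun setT f -> measurable_fun setT (fun x : R => f (x + s)).
Proof.
move=> mf; apply: (@measurableT_comp _ _ _ _ _ _ f) => //.
exact: measurable_funD.
Qed.

(** The target is the type on which Lebesgue measure lives, so that its image
    under the map is again comparable with Lebesgue measure. *)
Definition translate s : measurableTypeR R -> measurableTypeR R :=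
  fun x : R => x + s.

Let measurable_translate s : measurable_fun setT (translate s).
Proof. exact: measurable_funD. Qed.

(** Lebesgue measure is determined by its values on half-open intervals, whose
    lengths are unchanged by translation. *)
Lemma lebesgue_measure_shift s (A : set R) : measurable A ->
  pushforward mu (translate s) A = mu A.
Proof.
move=> mA; apply/esym.
pose m := pushforward mu (translate s).
have ms := measurable_translate s.
apply: (@lebesgue_measure_unique R m) => //= _ [[a b]] _ <-.
rewrite /m /pushforward.
have -> : translate s @^-1` `]a, b] = `](a - s), (b - s)]%classic.
  by apply/seteqP; split=> x /=; rewrite !in_itv/= ltrBlDr lerBrDr.
rewrite !lebesgue_measure_itv/= !lte_fin ltrD2r -!EFinD.
by congr (if _ then _%:E else _); ring.
Qed.

Lemma ge0_integral_shift (f : R -> \bar R) s :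
  measurable_fun setT f -> (forall x, 0 <= f x)%E ->
  (\int[mu]_x f (x + s)%R = \int[mu]_x f x)%E.
Proof.
move=> mf f0; transitivity (\int[pushforward mu (translate s)]_x f x)%E.
  apply/esym.
  exact: (ge0_integral_pushforward (measurable_translate s) mu measurableT mf).
apply: eq_measure_integral => A mA _; exact: lebesgue_measure_shift.
Qed.

Lemma integrable_shift f s : mu.-integrable setT (EFin \o f) ->
  mu.-integrable setT (EFin \o (fun x => f (x + s))).
Proof.
move=> /integrableP[/measurable_EFinP mf foo]; apply/integrableP; split.
  by apply/measurable_EFinP; exact: measurable_shift.
apply: le_lt_trans foo.
rewrite -(@ge0_integral_shift (fun x : R => `|(f x)%:E|%E) s)//.
by apply: measurableT_comp => //; exact/measurable_EFinP.
Qed.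

Lemma Rintegral_shift f s : mu.-integrable setT (EFin \o f) ->
  \int[mu]_x f (x + s) = \int[mu]_x f x.
Proof.
move=> intf; congr fine.
have mf : measurable_fun setT (EFin \o f) by case/integrableP: intf.
transitivity (\int[pushforward mu (translate s)]_x (f x)%:E)%E.
  apply/esym.
  exact: (integral_pushforward (measurable_translate s) mf
    (integrable_shift s intf)).
apply: eq_measure_integral => A mA _; exact: lebesgue_measure_shift.
Qed.

Lemma L2_shift f s : L2 f -> L2 (fun x => f (x + s)).
Proof.
move=> fL; apply/L2P; split.
  by apply: measurable_shift; exact: L2_measurable.
exact: (integrable_shift s (L2_sqr_integrable fL)).
Qed.

Lemma dot_shift f g s : L2 f -> L2 g ->
  dot (fun x => f (x + s)) g = dot f (fun x => g (x - s)).
Proof.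
move=> fL gL; rewrite /dot.
rewrite -(@Rintegral_shift (fun x => f x * g (x - s)) s); last first.
  by apply: L2_mul_integrable => //; exact: L2_shift.
by apply: eq_Rintegral => x _; rewrite addrK.
Qed.

Lemma L2norm_shift f s : L2 f -> L2norm (fun x => f (x + s)) = L2norm f.
Proof.
move=> fL; rewrite !L2normE//; last exact: L2_shift.
rewrite dot_shift//; last exact: L2_shift.
by congr (Num.sqrt (dot _ _)); apply/funext => x; rewrite subrK.
Qed.

Definition sdiff h f x := f (x + h) - f (x - h).

Lemma L2_sdiff h f : L2 f -> L2 (sdiff h f).
Proof. by move=> fL; apply: L2_sub; exact: L2_shift. Qed.

Lemma sdiff_skew h f g : L2 f -> L2 g ->
  dot (sdiff h f) g = - dot f (sdiff h g).
Proof.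
move=> fL gL; rewrite dotBl ?dotBr//; do ?exact: L2_shift.
by rewrite !dot_shift// opprK opprB.
Qed.

(** Both translates have the norm of [f], so only the cross term depends on
    [h]. *)
Lemma sdiff_norm h f : L2 f ->
  dot (sdiff h f) (sdiff h f) =
  2 * dot f f - 2 * dot (fun x => f (x + h)) (fun x => f (x - h)).
Proof.
move=> fL; rewrite dotBl ?dotBr//; do ?exact: L2_shift; last exact: L2_sdiff.
rewrite (dotC (fun x => f (x - h)) (fun x => f (x + h))).
have := L2norm_shift h fL; have := L2norm_shift (- h) fL.
move=> e1 e2.
rewrite -[in LHS]L2norm_sqr; last exact: L2_shift.
rewrite e2 -[dot (fun x => f (x - h)) _]L2norm_sqr; last exact: L2_shift.
by rewrite e1 L2norm_sqr//; ring.
Qed.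

End translation.

(** * Integrals over a moving window *)

Section window.
Context {R : realType}.
Local Notation mu := (@lebesgue_measure R).
Implicit Types (f g : R -> R) (h : R).

Definition window h f x := \int[mu]_(y in `[x - h, x + h]) f y.

(** The integral kernel of [window h]; its symmetry is what makes that operator
    self-adjoint. *)
Definition strip h (x y : R) : R := (`|x - y| <= h)%R%:R.

Lemma stripC h x y : strip h x y = strip h y x.
Proof. by rewrite /strip distrC. Qed.

Lemma strip_ge0 h x y : 0 <= strip h x y.
Proof. exact: ler0n. Qed.

Lemma strip_norm_le1 h x y : `|strip h x y| <= 1.
Proof. by rewrite ger0_norm ?strip_ge0// lern1 leq_b1. Qed.

Lemma strip_sqr h x y : strip h x y ^+ 2 = strip h x y.
Proof. by rewrite /strip; case: (_ <= _); rewrite ?expr1n ?expr0n. Qed.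

Lemma stripE h x : strip h x = \1_(`[x - h, x + h]) :> (R -> R).
Proof.
apply/funext => y; rewrite indicE /strip mem_setE in_itv/=; congr (_%:R).
by rewrite distrC ler_distl.
Qed.

Lemma windowE h f x : window h f x = \int[mu]_y (f y * strip h x y).
Proof.
rewrite /window Rintegral_mkcond; apply: eq_Rintegral => y _.
rewrite patchE stripE indicE; case: (y \in _); rewrite ?mulr1 ?mulr0//.
Qed.

Lemma measurable_strip2 h :
  measurable_fun setT (fun z : R * R => strip h z.1 z.2).
Proof.
apply: (@measurableT_comp _ _ _ _ _ _ (fun b : bool => b%:R : R)) => //.
apply: measurable_fun_ler => //; apply: measurableT_comp => //.
exact: measurable_funB.
Qed.

Lemma measurable_strip h x : measurable_fun setT (strip h x).
Proof. by rewrite stripE; exact/measurable_indicP. Qed.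

Lemma integral_strip h x : 0 <= h ->
  (\int[mu]_y (strip h x y)%:E = (2 * h)%:E)%E.
Proof.
move=> h0; rewrite stripE integral_indic//= setIT lebesgue_measure_itv/= lte_fin.
rewrite -EFinD; case: ltP => [_|]; first by congr EFin; ring.
by move=> ?; congr EFin; lra.
Qed.

Lemma integral_abse_strip h c x : 0 <= h ->
  (\int[mu]_y `|(c * strip h x y)%:E| = (2 * h)%:E * `|c%:E|)%E.
Proof.
move=> h0.
under eq_integral do
  rewrite EFinM abseM [X in (_ * X)%E]gee0_abs ?lee_fin ?strip_ge0//.
rewrite ge0_integralZl//.
- by rewrite integral_strip// muleC.
- by apply/measurable_EFinP; exact: measurable_strip.
- by move=> y _; rewrite lee_fin strip_ge0.
Qed.

Lemma L2_strip h x : 0 <= h -> L2 (strip h x).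
Proof.
move=> h0; apply/L2P; split; first exact: measurable_strip.
apply/integrableP; split.
  by apply/measurable_EFinP; apply: measurable_funX; exact: measurable_strip.
under eq_integral do rewrite /= ger0_norm ?sqr_ge0// strip_sqr.
by rewrite integral_strip// ltry.
Qed.

Lemma strip_dot h x : 0 <= h -> dot (strip h x) (strip h x) = 2 * h.
Proof.
move=> h0; rewrite /dot /Rintegral.
by under eq_integral do rewrite -expr2 strip_sqr; rewrite integral_strip.
Qed.

Lemma L2_mul_strip h f x : L2 f -> L2 (fun y => f y * strip h x y).
Proof.
move=> fL; apply: (L2_le _ fL).
  apply: measurable_funM; first exact: L2_measurable.
  exact: measurable_strip.
by move=> y; rewrite normrM ler_piMr// strip_norm_le1.
Qed.


(** Each section of the strip has length [2 * h], so Tonelli multiplies the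
    integral of the absolute value of [f] by [2 * h]. *)
Lemma integrable_strip_snd h f : 0 <= h -> mu.-integrable setT (EFin \o f) ->
  (mu \x mu)%E.-integrable setT
    (EFin \o (fun z : R * R => f z.2 * strip h z.1 z.2)).
Proof.
move=> h0 /integrableP[/measurable_EFinP mf foo].
apply/integrable21ltyP.
  apply/measurable_EFinP; apply: measurable_funM; last exact: measurable_strip2.
  exact: measurableT_comp.
have -> : (\int[mu]_y \int[mu]_x `|(f y * strip h x y)%:E| =
           \int[mu]_y ((2 * h)%:E * `|(f y)%:E|))%E.
  apply: eq_integral => y _; rewrite -(integral_abse_strip (f y) y h0).
  by apply: eq_integral => x _; rewrite stripC.
rewrite ge0_integralZl//.
- by rewrite lte_mul_pinfty// lee_fin mulr_ge0.
- by apply: measurableT_comp => //; exact/measurable_EFinP.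
- by rewrite lee_fin mulr_ge0.
Qed.

Lemma integrable_strip_fst h f : 0 <= h -> mu.-integrable setT (EFin \o f) ->
  (mu \x mu)%E.-integrable setT
    (EFin \o (fun z : R * R => f z.1 * strip h z.1 z.2)).
Proof.
move=> h0 /integrableP[/measurable_EFinP mf foo].
apply/integrable12ltyP.
  apply/measurable_EFinP; apply: measurable_funM; last exact: measurable_strip2.
  exact: measurableT_comp.
have -> : (\int[mu]_x \int[mu]_y `|(f x * strip h x y)%:E| =
           \int[mu]_x ((2 * h)%:E * `|(f x)%:E|))%E.
  by apply: eq_integral => x _; exact: integral_abse_strip.
rewrite ge0_integralZl//.
- by rewrite lte_mul_pinfty// lee_fin mulr_ge0.
- by apply: measurableT_comp => //; exact/measurable_EFinP.
- by rewrite lee_fin mulr_ge0.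
Qed.

(** Fubini does not apply, since [f] need not be integrable; the positive and
    negative parts are handled separately by Tonelli. *)
Lemma measurable_window h f :
  measurable_fun setT f -> measurable_fun setT (window h f).
Proof.
move=> mf.
have -> : window h f = fun x => \int[mu]_y (f y * strip h x y).
  by apply/funext => x; exact: windowE.
pose F := EFin \o (fun z : R * R => f z.2 * strip h z.1 z.2).
have mF : measurable_fun setT F.
  apply/measurable_EFinP; apply: measurable_funM; last exact: measurable_strip2.
  exact: measurableT_comp.
apply: (@measurableT_comp _ _ _ _ _ _ fine) => //.
have -> : (fun x : R => \int[mu]_y (f y * strip h x y)%:E)%E =
  ((fun x => \int[mu]_y F^\+ (x, y)) \- (fun x => \int[mu]_y F^\- (x, y)))%E.
  apply/funext => x; rewrite -[fun y : R => (f y * _)%:E]/(F \o pair x).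
  by rewrite integralE funepos_comp funeneg_comp.
apply: emeasurable_funB; apply: measurable_fun_fubini_tonelli_F => //.
- exact: measurable_funepos.
- exact: measurable_funeneg.
Qed.

(** Cauchy-Schwarz on the window, whose length is [2 * h]. *)
Lemma window_sqr_le h f x : 0 <= h -> L2 f ->
  window h f x ^+ 2 <= 2 * h * window h (fun y => f y ^+ 2) x.
Proof.
move=> h0 fL.
have -> : window h f x = dot (fun y => f y * strip h x y) (strip h x).
  rewrite windowE; apply: eq_Rintegral => y _.
  by rewrite -mulrA -expr2 strip_sqr.
have -> : window h (fun y => f y ^+ 2) x =
    dot (fun y => f y * strip h x y) (fun y => f y * strip h x y).
  rewrite windowE; apply: eq_Rintegral => y _.
  by rewrite -expr2 exprMn strip_sqr.
have fkL := L2_mul_strip h x fL; have kL := L2_strip x h0.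
rewrite -real_normK ?num_real// -(strip_dot x h0) -!L2norm_sqr// -exprMn.
rewrite lerXn2r ?nnegrE ?mulr_ge0 ?L2norm_ge0//.
by rewrite mulrC; exact: cauchy_schwarz.
Qed.

Lemma integrable_mul_strip h f x : mu.-integrable setT (EFin \o f) ->
  mu.-integrable setT (EFin \o (fun y => f y * strip h x y)).
Proof.
move=> fi; have mf : measurable_fun setT f.
  by case/integrableP: fi => /measurable_EFinP.
apply: (le_integrable _ _ _ fi) => //.
  apply/measurable_EFinP; apply: measurable_funM => //; exact: measurable_strip.
by move=> y _ /=; rewrite lee_fin normrM ler_piMr// strip_norm_le1.
Qed.

Lemma integrable_window h f : 0 <= h -> mu.-integrable setT (EFin \o f) ->
  mu.-integrable setT (EFin \o window h f).
Proof.
move=> h0 fi; have := integrable_fubini_F (integrable_strip_snd h0 fi).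
apply: eq_integrable => // x _.
rewrite /= windowE fineK//; apply: integrable_fin_num => //.
exact: integrable_mul_strip.
Qed.

Lemma L2_window h f : 0 <= h -> L2 f -> L2 (window h f).
Proof.
move=> h0 fL; have mw := measurable_window h (L2_measurable fL).
apply/L2P; split=> //.
have := integrable_window h0 (L2_sqr_integrable fL).
move/(integrableZl measurableT (2 * h)); apply: le_integrable => //.
  by apply/measurable_EFinP; exact: measurable_funX.
move=> x _ /=; rewrite lee_fin ger0_norm ?sqr_ge0//.
by rewrite (le_trans (window_sqr_le x h0 fL))// ler_norm.
Qed.

(** Fubini with the symmetric kernel; integrability on the plane follows from
    the bound |f(y) g(x)| <= f(y)^2 + g(x)^2 on the strip. *)
Lemma dot_window h f g : 0 <= h -> L2 f -> L2 g ->
  dot (window h f) g = dot f (window h g).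
Proof.
move=> h0 fL gL.
pose F := EFin \o (fun z : R * R => f z.2 * strip h z.1 z.2 * g z.1).
have mF : measurable_fun setT F.
  apply/measurable_EFinP; apply: measurable_funM; last first.
    by apply: measurableT_comp => //; exact: L2_measurable.
  apply: measurable_funM; last exact: measurable_strip2.
  by apply: measurableT_comp => //; exact: L2_measurable.
have iF : (mu \x mu)%E.-integrable setT F.
  have := integrableD measurableT
    (integrable_strip_snd h0 (L2_sqr_integrable fL))
    (integrable_strip_fst h0 (L2_sqr_integrable gL)).
  apply: le_integrable => //.
  move=> [x y] _ /=; rewrite lee_fin -mulrDl mulrAC !normrM.
  apply: ler_wpM2r => //.
  rewrite -normrM [leRHS]ger0_norm ?addr_ge0 ?sqr_ge0// ler_norml.
  by have := sqr_ge0 (f y + g x); have := sqr_ge0 (f y - g x); nra.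
have -> : dot (window h f) g = fine (\int[mu]_x \int[mu]_y F (x, y))%E.
  congr fine; apply: eq_integral => x _.
  rewrite windowE mulrC -RintegralZl//; last first.
    have := L2_mul_integrable fL (L2_strip x h0); exact.
  rewrite fineK.
    by apply: eq_integral => y _; rewrite /F/= mulrC.
  apply: integrable_fin_num => //.
  have := integrableZl measurableT (g x) (L2_mul_integrable fL (L2_strip x h0)).
  by apply: eq_integrable => // y _; rewrite /= EFinM.
have -> : dot f (window h g) = fine (\int[mu]_y \int[mu]_x F (x, y))%E.
  congr fine; apply: eq_integral => y _.
  rewrite windowE -RintegralZl//; last first.
    have := L2_mul_integrable gL (L2_strip y h0); exact.
  rewrite fineK.
    by apply: eq_integral => x _; rewrite /F/= (stripC h x y); congr EFin; ring.
  apply: integrable_fin_num => //.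
  have := integrableZl measurableT (f y) (L2_mul_integrable gL (L2_strip y h0)).
  by apply: eq_integrable => // x _; rewrite /= EFinM.
by rewrite (Fubini iF).
Qed.

Lemma Rintegral_window h f : 0 <= h -> mu.-integrable setT (EFin \o f) ->
  \int[mu]_x window h f x = 2 * h * \int[mu]_x f x.
Proof.
move=> h0 fi; have si := integrable_strip_snd h0 fi.
have -> : \int[mu]_x window h f x =
    fine (\int[mu]_x \int[mu]_y (f y * strip h x y)%:E)%E.
  congr fine; apply: eq_integral => x _.
  by rewrite windowE fineK//; exact/integrable_fin_num/integrable_mul_strip.
have /= -> := Fubini si.
rewrite -RintegralZl//; congr fine; apply: eq_integral => y _.
have ti : mu.-integrable setT (EFin \o strip h y).
  apply/integrableP; split.
    by apply/measurable_EFinP; exact: measurable_strip.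
  under eq_integral do rewrite /= ger0_norm ?strip_ge0//.
  by rewrite integral_strip// ltry.
under eq_integral do rewrite EFinM stripC.
by rewrite integralZl// integral_strip// -EFinM mulrC.
Qed.

Lemma L2norm_window h f : 0 <= h -> L2 f ->
  L2norm (window h f) <= 2 * h * L2norm f.
Proof.
move=> h0 fL.
have h20 : 0 <= 2 * h by rewrite mulr_ge0.
have wL := L2_window h0 fL.
rewrite -ler_sqr ?nnegrE ?mulr_ge0 ?L2norm_ge0// exprMn !L2norm_sqr//.
have f2i := L2_sqr_integrable fL.
have w2i := integrable_window h0 f2i.
have -> : (2 * h) ^+ 2 * dot f f =
    \int[mu]_x (2 * h * window h (fun y => f y ^+ 2) x).
  rewrite RintegralZl// Rintegral_window//= expr2 -(mulrA (2 * h)).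
  congr (_ * (_ * _)).
apply: le_Rintegral => //.
- exact: L2_mul_integrable.
- have := integrableZl measurableT (2 * h) w2i; exact: eq_integrable.
- by move=> x _; rewrite -expr2; exact: window_sqr_le.
Qed.

Lemma window_add h f g : 0 <= h -> L2 f -> L2 g ->
  window h (fun x => f x + g x) = (fun x => window h f x + window h g x).
Proof.
move=> h0 fL gL; apply/funext => x; rewrite !windowE.
under eq_Rintegral do rewrite mulrDl.
by rewrite RintegralD//; [exact: (L2_mul_integrable fL (L2_strip x h0))
  |exact: (L2_mul_integrable gL (L2_strip x h0))].
Qed.

Lemma window_scale h c f : 0 <= h -> L2 f ->
  window h (fun x => c * f x) = (fun x => c * window h f x).
Proof.
move=> h0 fL; apply/funext => x; rewrite !windowE.
under eq_Rintegral do rewrite -mulrA.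
by rewrite RintegralZl//; exact: (L2_mul_integrable fL (L2_strip x h0)).
Qed.

End window.

(** * Smooth functions and test functions *)

Section smooth.
Context {R : realType}.
Implicit Types (f g : R -> R) (x y c d h : R) (k n : nat).

Definition smooth f := forall n x, derivable (f^`(n))%classic x 1.

Lemma derive1_is_derive f g : (forall x, is_derive x 1 f (g x)) ->
  (f^`())%classic = g.
Proof. by move=> fg; apply/funext => x; rewrite derive1E derive_val. Qed.

Lemma smooth_is_derive f : smooth f ->
  forall x, is_derive x 1 f ((f^`())%classic x).
Proof. by move=> fs x; apply: DeriveDef; [exact: (fs 0%N)|rewrite derive1E]. Qed.

Lemma smooth_derive1 f : smooth f -> smooth (f^`())%classic.
Proof. by move=> fs n x; rewrite -derive1Sn; exact: (fs n.+1). Qed.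

Lemma smooth_primitive f g : (forall x, is_derive x 1 f (g x)) ->
  smooth g -> smooth f.
Proof.
move=> fg gs [|n] x; first exact: ex_derive.
by rewrite derive1Sn (derive1_is_derive fg); exact: gs.
Qed.

(** Coinduction: a class of functions in which every member has a derivative
    inside the class consists of smooth functions. *)
Lemma smooth_coind (P : (R -> R) -> Prop) :
  (forall f, P f -> exists g, P g /\ forall x, is_derive x 1 f (g x)) ->
  forall f, P f -> smooth f.
Proof.
move=> Pder f Pf n; elim: n f Pf => [|n IH] f Pf x.
  by have [g [_ fg]] := Pder f Pf; exact: ex_derive.
have [g [Pg fg]] := Pder f Pf.
by rewrite derive1Sn (derive1_is_derive fg); exact: IH.
Qed.

Lemma smooth_continuous f : smooth f -> continuous f.
Proof.
move=> fs x; apply: differentiable_continuous.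
by apply/derivable1_diffP; exact: (fs 0%N).
Qed.

(** The functions x^-k exp(-1/x), extended by 0.  The index [k] is there because
    the family, unlike exp(-1/x) alone, is stable under differentiation up to
    linear combinations. *)
Definition flat k x : R := if 0 < x then x^-1 ^+ k * expR (- x^-1) else 0.

(** With y = 1/x this is y^(k+1) <= (k+1)! exp y.  It gives continuity at 0 for
    every [k], hence also differentiability at 0, because the difference
    quotient of [flat k] there is [flat k.+1]. *)
Lemma flat_le k x : `|flat k x| <= k.+1`!%:R * `|x|.
Proof.
rewrite /flat; case: ltP => [x0|_]; last by rewrite normr0 mulr_ge0.
have y0 : 0 < x^-1 by rewrite invr_gt0.
rewrite gtr0_norm ?mulr_gt0 ?exprn_gt0 ?expR_gt0// gtr0_norm//.
rewrite expRN ler_pdivrMr ?expR_gt0//.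
have -> : x^-1 ^+ k = x * x^-1 ^+ k.+1 by rewrite exprS mulVKf ?gt_eqF.
rewrite -mulrA mulrCA ler_pM2l// -ler_pdivrMl ?ltr0n ?fact_gt0//.
rewrite mulrC (le_trans _ (expR_ge1Dxn k (ltW y0)))//.
by rewrite lerDr.
Qed.

Lemma is_derive_flat k x :
  is_derive x 1 (flat k) (- k%:R * flat k.+1 x + flat k.+2 x).
Proof.
have [x0|x0|->] := ltgtP x 0.
- rewrite /flat !ltNge !(ltW x0)/= mulr0 addr0.
  apply: (near_eq_is_derive (f := cst 0)).
  near=> y; rewrite ltNge.
  have /ltW -> // : y < 0 by near: y; exact: lt_nbhsl.
- rewrite /flat !x0.
  have xn0 : x != 0 by rewrite gt_eqF.
  have dinv : is_derive x 1 (fun y : R => y^-1) (- x ^- 2 *: 1).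
    exact: is_deriveV.
  have dN : is_derive x 1 (fun y : R => - y^-1) (x ^- 2).
    have := is_deriveN dinv; by rewrite scaleNr opprK /GRing.scale/= mulr1.
  have dexp : is_derive x 1 (fun y : R => expR (- y^-1)) (expR (- x^-1) * x ^- 2).
    exact: (@is_derive1_comp R expR (fun y => - y^-1) x _ _ (is_derive_expR _) dN).
  have dX : is_derive x 1 (fun y : R => y^-1 ^+ k) (- k%:R * x^-1 ^+ k.+1).
    have := is_deriveX k dinv.
    have -> : (@GRing.inv R) ^+ k = fun y => y^-1 ^+ k by exact: exprfctE.
    move/is_derive_eq; apply.
    rewrite /GRing.scale/= mulr1 mulrN !mulNr; congr (- _).
    rewrite -exprVn -mulrA -exprD; case: (k) => [|m]; first by rewrite !mul0r.
    by rewrite addn2.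
  have dM := is_deriveM dX dexp.
  apply: near_eq_is_derive; last first.
    apply: (is_derive_eq dM).
    rewrite /GRing.scale/= -!exprVn !exprS expr0; ring.
  near=> y.
  have -> // : 0 < y by near: y; exact: lt_nbhsr.
- have f0 j : flat j 0 = 0 by rewrite /flat ltxx.
  rewrite !f0 mulr0 addr0.
  have quot : h^-1 *: (flat k (h *: 1 + 0) - flat k 0) @[h --> (0:R)^'] --> (0:R).
    apply/cvgr0Pnorm_lt => e e0.
    near=> y.
    have yn0 : y != 0 by near: y; exact: nbhs_dnbhs_neq.
    rewrite f0 subr0 /GRing.scale/= mulr1 addr0.
    have -> : y^-1 * flat k y = flat k.+1 y.
      by rewrite /flat; case: ifP => _; rewrite ?mulr0// exprS mulrA.
    rewrite (le_lt_trans (flat_le _ _))// mulrC -ltr_pdivlMr ?ltr0n ?fact_gt0//.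
    near: y; apply: dnbhs0_lt; by rewrite divr_gt0// ltr0n fact_gt0.
  apply: DeriveDef; first by apply/cvg_ex; exists 0.
  exact/cvg_lim.
Unshelve. all: by end_near. Qed.


(** The closure of the smooth functions and the [flat k] under the operations
    used below.  Being stable under differentiation, it is handled by
    [smooth_coind], with no Leibniz formula for higher derivatives. *)
Inductive smooth_expr : (R -> R) -> Prop :=
| Smooth_base f : smooth f -> smooth_expr f
| Smooth_flat k : smooth_expr (flat k)
| Smooth_cst c : smooth_expr (fun=> c)
| Smooth_add f g : smooth_expr f -> smooth_expr g ->
    smooth_expr (fun x => f x + g x)
| Smooth_mul f g : smooth_expr f -> smooth_expr g ->
    smooth_expr (fun x => f x * g x)
| Smooth_affine f c d : smooth_expr f -> smooth_expr (fun x => f (c * x + d)).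

Lemma smooth_expr_smooth f : smooth_expr f -> smooth f.
Proof.
move: f; apply: smooth_coind => f; elim=> {f}.
- move=> f fs; exists (f^`())%classic; split.
    by apply: Smooth_base; exact: smooth_derive1.
  exact: smooth_is_derive.
- move=> k; exists (fun x => - k%:R * flat k.+1 x + flat k.+2 x); split.
    apply: Smooth_add; last exact: Smooth_flat.
    by apply: Smooth_mul; [exact: Smooth_cst|exact: Smooth_flat].
  exact: is_derive_flat.
- move=> c; exists (fun=> 0); split; first exact: Smooth_cst.
  by move=> x; exact: is_derive_cst.
- move=> f g fe [f' [f'e df]] ge [g' [g'e dg]].
  exists (fun x => f' x + g' x); split; first exact: Smooth_add.
  by move=> x; exact: is_deriveD.
- move=> f g fe [f' [f'e df]] ge [g' [g'e dg]].
  exists (fun x => f x * g' x + g x * f' x); split.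
    by apply: Smooth_add; apply: Smooth_mul.
  by move=> x; exact: is_deriveM.
- move=> f c d fe [f' [f'e df]].
  exists (fun x => c * f' (c * x + d)); split.
    by apply: Smooth_mul; [exact: Smooth_cst|exact: Smooth_affine].
  move=> x.
  have daff : is_derive x 1 (fun y : R => c * y + d) c.
    have dc : is_derive x 1 (fun y : R => c * y) c.
      by have := is_deriveZ c (is_derive_id x (1:R)); rewrite /GRing.scale/= mulr1.
    by have := is_deriveD dc (is_derive_cst d x 1); rewrite addr0.
  rewrite mulrC.
  exact: (@is_derive1_comp R f (fun y => c * y + d) x _ _ (df _) daff).
Qed.

(** Compact support in the usable form of vanishing outside a ball. *)
Lemma test_functionP f : test_function f <->
  smooth f /\ exists M, forall x, M < `|x| -> f x = 0.
Proof.
split=> [[fs fc]|[fs [M fM]]]; split=> //.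
  have [M [_ HM]] := compact_bounded fc.
  exists (M + 1) => x Mx; apply/eqP; apply: contrapT => /negP fx0.
  have M1 : M < M + 1 by rewrite ltrDl.
  have xc : closure [set x | f x != 0] x by exact: subset_closure.
  by have /(_ x xc) /= := HM _ M1; rewrite leNgt Mx.
apply: (subclosed_compact (@closed_closure _ _) (@segment_compact R (- M) M)).
have segc : closed (`[- M, M]%classic : set R) by exact: interval_closed.
rewrite (closure_id `[- M, M]%classic).1//; apply: closure_subset => x /=.
rewrite in_itv/= -ler_norml => fx0; rewrite leNgt; apply/negP => Mx.
by move: fx0; rewrite fM// eqxx.
Qed.

Lemma test_function_integrable f : test_function f ->
  (@lebesgue_measure R).-integrable setT (EFin \o f).
Proof.
move=> /test_functionP[/smooth_continuous fc [M fM]].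
have mf := continuous_measurable_fun fc.
have si : (@lebesgue_measure R).-integrable `[- M, M] (EFin \o f).
  apply: continuous_compact_integrable; first exact: segment_compact.
  exact: continuous_subspaceT.
have /integrable_mkcond - /(_ (measurable_itv _)) := si.
apply: eq_integrable => // x _; rewrite patchE; case: ifPn => // xM.
rewrite /= fM// ltNge ler_norml; apply: contra xM => xM.
by rewrite inE/= in_itv.
Qed.

Lemma test_function_L2 f : test_function f -> L2 f.
Proof.
move=> ft; have /test_functionP[fs [M fM]] := ft.
apply/L2P; split.
  by apply: continuous_measurable_fun; exact: smooth_continuous.
apply: test_function_integrable; apply/test_functionP; split.
  by apply: smooth_expr_smooth; apply: Smooth_mul; exact: Smooth_base.
by exists M => x /fM ->; rewrite expr0n.
Qed.


Lemma window_primitive h f x : 0 <= h ->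
  (@lebesgue_measure R).-integrable setT (EFin \o f) ->
  window h f x = sdiff h (primitive f) x.
Proof.
move=> h0 fi; rewrite /sdiff /primitive Rintegral_itvB//.
- rewrite /window Rintegral_itv_obnd_cbnd//.
  by apply: integrableS fi.
- by apply: integrableS fi.
- by rewrite bnd_simp; lra.
Qed.

Lemma is_derive_primitive f x : test_function f ->
  is_derive x 1 (primitive f) (f x).
Proof.
move=> ft; have /test_functionP[/smooth_continuous fc _] := ft.
have fi : (@lebesgue_measure R).-integrable `]-oo, x + 1] (EFin \o f).
  by apply: integrableS (test_function_integrable ft).
have x1 : x < x + 1 by rewrite ltrDl.
have /(_ (ltNyr x) (fc x)) [d e] := continuous_FTC1 x1 fi.
by apply: DeriveDef; [exact: d|rewrite -derive1E; exact: e].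
Qed.

Lemma test_function_sdiff h f : test_function f -> test_function (sdiff h f).
Proof.
move=> /test_functionP[fs [M fM]]; apply/test_functionP; split.
  have -> : sdiff h f = fun x => f (1 * x + h) + (-1) * f (1 * x + (- h)).
    by apply/funext => x; rewrite /sdiff !mul1r mulN1r.
  apply: smooth_expr_smooth; apply: Smooth_add.
    by apply: Smooth_affine; exact: Smooth_base.
  apply: Smooth_mul; first exact: Smooth_cst.
  by apply: Smooth_affine; exact: Smooth_base.
exists (M + `|h|) => x Mx; rewrite /sdiff !fM ?subr0//.
  by have := ler_normD (x - h) h; rewrite subrK; lra.
by have := ler_normB (x + h) h; rewrite addrK; lra.
Qed.

Lemma is_derive_sdiff h f g x : (forall y, is_derive y 1 f (g y)) ->
  is_derive x 1 (sdiff h f) (sdiff h g x).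
Proof.
move=> fg; have shifted d : is_derive x 1 (fun y : R => f (y + d)) (g (x + d)).
  have der : is_derive x 1 (fun y : R => y + d) (1 : R).
    have := is_deriveD (is_derive_id x (1 : R)) (is_derive_cst d x 1).
    by rewrite addr0.
  rewrite -[g _]mulr1.
  exact: (@is_derive1_comp R f (fun y => y + d) x _ _ (fg _) der).
exact: is_deriveB.
Qed.

Lemma is_derive_window h f x : 0 <= h -> test_function f ->
  is_derive x 1 (window h f) (sdiff h f x).
Proof.
move=> h0 ft.
have -> : window h f = sdiff h (primitive f).
  apply/funext => y; apply: window_primitive => //.
  exact: test_function_integrable.
by apply: is_derive_sdiff => y; exact: is_derive_primitive.
Qed.

Lemma test_function_window h f : 0 <= h -> test_function f ->
  test_function (window h f).
Proof.
move=> h0 ft; apply/test_functionP; split.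
  apply: smooth_primitive; first by move=> x; exact: is_derive_window.
  by have /test_functionP[] := test_function_sdiff h ft.
have /test_functionP[_ [M fM]] := ft.
exists (M + h) => x Mx.
have -> : window h f x = \int[@lebesgue_measure R]_(y in `[x - h, x + h]) 0.
  apply: eq_Rintegral => y; rewrite inE/= in_itv/= -ler_distlC => yx; apply: fM.
  by have := ler_normD (x - y) y; rewrite subrK; lra.
by rewrite /Rintegral integral0.
Qed.

(** Here smoothing and differencing meet: each [window] absorbs one derivative
    and leaves one [sdiff]. *)
Lemma window_window_derive2 h f : 0 <= h -> test_function f ->
  ((window h (window h f))^`(2))%classic = sdiff h (sdiff h f).
Proof.
move=> h0 ft; rewrite derive1nS derive1n1.
have wft := test_function_window h0 ft.
rewrite (derive1_is_derive (fun x => is_derive_window x h0 wft)).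
apply: derive1_is_derive => x; apply: is_derive_sdiff => y.
exact: is_derive_window.
Qed.

End smooth.

(** * Weak second derivatives *)

Section weak_derivative.
Context {R : realType}.
Local Notation mu := (@lebesgue_measure R).
Implicit Types (f g u w : R -> R) (a b h x : R) (n : nat).

(** As [n] grows these test functions converge to the indicator of the open
    interval, so that they stand in for a mollification of it. *)
Definition smooth_bump n a b x : R :=
  flat 0 (n.+1%:R * (x - a)) * flat 0 (n.+1%:R * (b - x)).

Lemma flat0_itv x : 0 <= flat 0 x <= 1.
Proof.
rewrite /flat expr0 mul1r; case: ltP => [x0|_]; last by rewrite lexx ler01.
by rewrite expR_ge0 -expR0 ler_expR oppr_le0 invr_ge0 ltW.
Qed.

Lemma smooth_bump_itv n a b x : 0 <= smooth_bump n a b x <= 1.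
Proof.
have /andP[p0 p1] := flat0_itv (n.+1%:R * (x - a)).
have /andP[q0 q1] := flat0_itv (n.+1%:R * (b - x)).
by rewrite /smooth_bump mulr_ge0//= mulr_ile1.
Qed.

Lemma smooth_bump_out n a b x : x \notin `]a, b[ -> smooth_bump n a b x = 0.
Proof.
rewrite in_itv/= negb_and -!leNgt => /orP[xa|bx]; rewrite /smooth_bump /flat.
  by rewrite pmulr_rgt0// subr_gt0 ltNge xa mul0r.
by rewrite [X in _ * X]ifF ?mulr0// pmulr_rgt0// subr_gt0 ltNge bx.
Qed.

Lemma test_function_smooth_bump n a b : test_function (smooth_bump n a b).
Proof.
apply/test_functionP; split.
  have -> : smooth_bump n a b = fun x => flat 0 (n.+1%:R * x + - (n.+1%:R * a)) *
                                  flat 0 (- n.+1%:R * x + n.+1%:R * b).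
    by apply/funext => x; rewrite /smooth_bump; congr (flat _ _ * flat _ _); ring.
  by apply: smooth_expr_smooth; apply: Smooth_mul; apply: Smooth_affine;
    exact: Smooth_flat.
exists (`|a| + `|b|) => x xM; apply: smooth_bump_out; rewrite in_itv/=.
apply/negP => /andP[ax xb].
have := ler_norm b; have := ler_norm (- a); rewrite normrN => aa bb.
by move: xM; apply/negP; rewrite -leNgt ler_norml; apply/andP; split;
  have := normr_ge0 a; have := normr_ge0 b; lra.
Qed.

Lemma flat0_cvg x : 0 < x -> flat 0 (n.+1%:R * x) @[n --> \oo] --> (1 : R).
Proof.
move=> x0.
have -> : (fun n => flat 0 (n.+1%:R * x)) = (fun n => expR (- (x^-1 * n.+1%:R^-1))).
  by apply/funext => n; rewrite /flat pmulr_rgt0// x0 expr0 mul1r invfM mulrC.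
suff : expR (- (x^-1 * n.+1%:R^-1)) @[n --> \oo] --> expR (- (x^-1 * 0)).
  by rewrite mulr0 oppr0 expR0.
apply: continuous_cvg; first exact: continuous_expR.
by apply: cvgN; apply: cvgM; [exact: cvg_cst|exact: cvg_harmonic].
Qed.

Lemma smooth_bump_cvg a b x :
  smooth_bump n a b x @[n --> \oo] --> (\1_(`]a, b[) x : R).
Proof.
rewrite indicE mem_setE; case: (boolP (x \in _)) => xab; last first.
  rewrite (_ : (fun n => smooth_bump n a b x) = cst 0); first exact: cvg_cst.
  by apply/funext => n; rewrite smooth_bump_out.
move: xab; rewrite in_itv/= => /andP[ax xb].
rewrite -[true%:R]mulr1; apply: cvgM; apply: flat0_cvg; lra.
Qed.

Lemma L2_indic_oo a b : L2 (\1_(`]a, b[) : R -> R).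
Proof.
apply/L2P; split; first exact/measurable_indicP.
have := @integrable_indic_itv R a b false true.
apply: eq_integrable => // x _ /=; rewrite indicE.
by case: (_ \in _); rewrite ?expr1n ?expr0n.
Qed.

(** Dominated convergence along the bumps approximating the indicator. *)
Lemma orthogonal_test_integral w a b : L2 w ->
  (forall phi, test_function phi -> dot w phi = 0) ->
  \int[mu]_x (w x * \1_(`]a, b[) x) = 0.
Proof.
move=> wL w0.
pose F n x := (w x * smooth_bump n a b x)%:E.
have Fm n : measurable_fun setT (F n).
  apply/measurable_EFinP; apply: measurable_funM; first exact: L2_measurable.
  by apply: L2_measurable; apply: test_function_L2; exact: test_function_smooth_bump.
have iL := L2_mul_integrable wL (L2_indic_oo a b).
have [] := @dominated_convergence _ _ R mu setT measurableT F
  (fun x => (w x * \1_(`]a, b[) x)%:E)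
  (fun x => `|(w x * \1_(`]a, b[) x)%:E|%E) Fm.
- by case/integrableP: iL.
- apply: aeW => x _; apply: cvg_EFin; first exact: nearW.
  by apply: cvgM; [exact: cvg_cst|exact: smooth_bump_cvg].
- exact: integrable_abse.
- apply: aeW => x n _ /=; rewrite lee_fin normrM [leRHS]normrM ler_wpM2l//.
  rewrite indicE mem_setE; case: (boolP (x \in _)) => xab.
    by have /andP[b0 b1] := smooth_bump_itv n a b x;
      rewrite (ger0_norm b0) ger0_norm// ler0n.
  by rewrite smooth_bump_out// normr0.
- move=> _ _ lim.
  have F0 n : (\int[mu]_x F n x = 0)%E.
    have := w0 _ (test_function_smooth_bump n a b).
    rewrite /dot /Rintegral => e.
    rewrite -(@fineK _ (\int[mu]_x F n x)) ?e//; apply: integrable_fin_num => //.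
    apply: L2_mul_integrable => //; apply: test_function_L2.
    exact: test_function_smooth_bump.
  rewrite /Rintegral; suff -> : (\int[mu]_x (w x * \1_(`]a, b[) x)%:E = 0)%E by [].
  move: lim; under eq_fun do rewrite F0.
  by move/cvg_lim => <- //; rewrite lim_cst.
Qed.


Lemma L2_locally_integrable w : L2 w -> locally_integrable setT w.
Proof.
move=> wL; split; [exact: L2_measurable|exact: openT|move=> K _ Kc].
have [M [_ HM]] := compact_bounded Kc.
have M1 : M < M + 1 by rewrite ltrDl.
have KM : K `<=` `](- (M + 2)), M + 2[.
  move=> x Kx; have /(_ x Kx)/= := HM _ M1.
  by rewrite in_itv/= ler_norml => /andP[? ?]; apply/andP; split; lra.
have mw : measurable_fun setT w := L2_measurable wL.
have /integrableP[_] := L2_mul_integrable wL (L2_indic_oo (- (M + 2)) (M + 2)).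
apply: le_lt_trans; rewrite integral_mkcond.
apply: ge0_le_integral => //.
- by move=> x _; rewrite patchE; case: ifP.
- apply/(measurable_restrictT _ _).1; first exact: compact_measurable.
  apply: measurable_funTS; apply/measurable_EFinP; exact: measurableT_comp.
- apply: measurableT_comp => //; apply/measurable_EFinP.
  by apply: measurable_funM => //; exact/L2_measurable/L2_indic_oo.
- move=> x _; rewrite patchE; case: ifPn => [/set_mem/KM xM|_]; last exact: abse_ge0.
  by rewrite /= indicE mem_set// mulr1.
Qed.

(** All integrals of [w] over bounded intervals vanish, so the Lebesgue
    differentiation theorem applied to the primitive 0 identifies [w]. *)
Lemma orthogonal_test_ae w : L2 w ->
  (forall phi, test_function phi -> dot w phi = 0) ->
  {ae mu, forall x, w x = 0}.
Proof.
move=> wL w0.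
have wioo a b : mu.-integrable `]a, b[ (EFin \o w).
  apply/integrable_mkcond => //.
  have := L2_mul_integrable wL (L2_indic_oo a b).
  apply: eq_integrable => // x _; rewrite patchE /= indicE.
  by case: (_ \in _); rewrite ?mulr1 ?mulr0.
have wicc a b : mu.-integrable `[a, b] (EFin \o w).
  apply: integrableS (wioo (a - 1) (b + 1)) => //.
  by apply: subset_itv; rewrite bnd_simp ?ltrBlDr ltrDl.
have wab a b : \int[mu]_(x in `[a, b]) w x = 0.
  rewrite -Rintegral_itv_obnd_cbnd; last first.
    by apply: integrableS (wicc a b) => //; exact: subset_itv_oc_cc.
  rewrite -Rintegral_itv_bndo_bndc// Rintegral_mkcond.
  rewrite -[RHS](orthogonal_test_integral a b wL w0).
  apply: eq_Rintegral => x _; rewrite patchE indicE.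
  by case: (_ \in _); rewrite ?mulr1 ?mulr0.
have wn n : {ae mu, forall x, - n%:R < x -> w x = 0}.
  have := FTC1 (wicc (- n%:R)) (L2_locally_integrable wL).
  apply: filterS; first exact: (ae_filter_ringOfSetsType mu).
  move=> x /= H nx; have [|_ <-] := H; first by rewrite lte_fin.
  have -> : (fun y => \int[mu]_(t in `[- n%:R, y]) w t) = cst 0.
    by apply/funext => y; exact: wab.
  exact: derive1_cst.
have := ae_foralln wn; apply: filterS => x /=.
move/(_ (Num.bound `|x|)); apply.
by rewrite ltrNl (le_lt_trans _ (archi_boundP (normr_ge0 x)))// -normrN ler_norm.
Qed.

Lemma dot_ae0 w f : L2 w -> L2 f -> {ae mu, forall x, w x = 0} -> dot w f = 0.
Proof.
move=> wL fL w0; rewrite /dot /Rintegral (ae_eq_integral (cst 0%E))//.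
- by rewrite integral0.
- by case/integrableP: (L2_mul_integrable wL fL).
- apply: filterS w0; first exact: (ae_filter_ringOfSetsType mu).
  by move=> x /= -> _; rewrite mul0r.
Qed.

(** The weak form of u_xx passes to the regularized functions: both sides equal
    <D D u, f>, the left one by S S g = D D u, which is tested against phi
    through the test function S S phi. *)
Lemma weak_derivative2_window h u g f : 0 <= h -> L2 u -> L2 g -> L2 f ->
  weak_derivative 2 u g ->
  dot (window h g) (window h f) = - dot (sdiff h u) (sdiff h f).
Proof.
move=> h0 uL gL fL ug.
have wwL : L2 (window h (window h g)) by do 2 apply: L2_window => //.
have ddL : L2 (sdiff h (sdiff h u)) by do 2 apply: L2_sdiff.
rewrite -sdiff_skew//; last exact: L2_sdiff.
rewrite -dot_window//; last exact: L2_window.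
apply/eqP; rewrite -subr_eq0 -dotBl//; apply/eqP.
apply: dot_ae0 => //; first exact: L2_sub.
apply: orthogonal_test_ae; first exact: L2_sub.
move=> phi phit; have phiL := test_function_L2 phit.
rewrite dotBl//; apply/eqP; rewrite subr_eq0; apply/eqP.
rewrite !dot_window//; do ?exact: L2_window.
rewrite sdiff_skew ?sdiff_skew ?opprK//; do ?exact: L2_sdiff.
have := ug _ (test_function_window h0 (test_function_window h0 phit)).
by rewrite window_window_derive2// sqrrN expr1n mul1r.
Qed.

End weak_derivative.

(** * Asymptotic orthogonality of translates *)

Section far_translates.
Context {R : realType}.
Local Notation mu := (@lebesgue_measure R).
Implicit Types (f g : R -> R) (h x : R) (n : nat).

Definition far h f x := f x * (h <= `|x|)%R%:R.

Lemma measurable_far h f :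
  measurable_fun setT f -> measurable_fun setT (far h f).
Proof.
move=> mf; apply: measurable_funM => //.
apply: (@measurableT_comp _ _ _ _ _ _ (fun b : bool => b%:R : R)) => //.
by apply: measurable_fun_ler => //; exact: measurableT_comp.
Qed.

Lemma far_le h f x : `|far h f x| <= `|f x|.
Proof. by rewrite normrM ler_piMr// ger0_norm ?ler0n// lern1 leq_b1. Qed.

Lemma L2_far h f : L2 f -> L2 (far h f).
Proof.
move=> fL; apply: (L2_le _ fL); last exact: far_le.
by apply: measurable_far; exact: L2_measurable.
Qed.

Lemma L2norm_le f g : L2 f -> L2 g -> (forall x, `|f x| <= `|g x|) ->
  L2norm f <= L2norm g.
Proof.
move=> fL gL fg; rewrite -ler_sqr ?nnegrE ?L2norm_ge0// !L2norm_sqr//.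
apply: le_Rintegral => //; do ?exact: L2_mul_integrable.
by move=> x _; rewrite -!expr2 -[leLHS]real_normK ?num_real//
  -[leRHS]real_normK ?num_real// lerXn2r ?nnegrE.
Qed.

Lemma L2norm_far_cvg0 f : L2 f -> L2norm (far n%:R f) @[n --> \oo] --> (0 : R).
Proof.
move=> fL.
have fi := L2_sqr_integrable fL.
pose F n x := (far n%:R f x ^+ 2)%:E.
have Fi n : mu.-integrable setT (F n) by apply: L2_sqr_integrable; exact: L2_far.
have [] := @dominated_convergence _ _ R mu setT measurableT F (cst 0%E)
  (fun x => (f x ^+ 2)%:E).
- by move=> n; case/integrableP: (Fi n).
- exact: measurable_cst.
- apply: aeW => x _; apply: cvg_EFin; first exact: nearW.
  apply: cvg_near_cst; near=> n => /=.
  rewrite /far.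
  have -> : (n%:R <= `|x|) = false.
    apply/negbTE; rewrite -ltNge; near: n; exact: nbhs_infty_gtr.
  by rewrite mulr0 expr0n.
- exact: fi.
- apply: aeW => x n _ /=; rewrite lee_fin ger0_norm ?sqr_ge0//.
  rewrite -[leLHS]real_normK ?num_real// -[leRHS]real_normK ?num_real//.
  by rewrite lerXn2r ?nnegrE//; exact: far_le.
move=> _ _; rewrite integral0 => /fine_cvgP[_ lim].
rewrite -[X in _ --> X]sqrtr0.
have -> : (fun n => L2norm (far n%:R f)) =
    (fun n => Num.sqrt (fine (\int[mu]_x F n x))).
  apply/funext => n; rewrite L2normE; last exact: L2_far.
  by congr Num.sqrt; apply: eq_Rintegral => x _; rewrite expr2.
apply: continuous_cvg; first exact: sqrt_continuous.
exact: lim.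
Unshelve. all: by end_near. Qed.

(** Of the points x + h and x - h at least one has absolute value at least [h],
    so the product of the two translates only sees the part of [f] far from the
    origin. *)
Lemma dot_translates_le h f : L2 f ->
  `|dot (fun x => f (x + h)) (fun x => f (x - h))|
    <= 2 * L2norm f * L2norm (far h f).
Proof.
move=> fL; have farL := L2_far h fL.
pose core x := f x - far h f x.
have coreL : L2 core by exact: L2_sub.
have core_le : L2norm core <= L2norm f.
  apply: L2norm_le => // x; rewrite /core /far; case: (h <= `|x|).
    by rewrite mulr1n mulr1 subrr normr0.
  by rewrite mulr0n mulr0 subr0.
have splitf : f = fun x => far h f x + core x.
  by apply/funext => x; rewrite /core addrC subrK.
have core0 : dot (fun x => core (x + h)) (fun x => core (x - h)) = 0.
  rewrite /dot -[RHS](_ : \int[mu]_x 0 = 0); last by rewrite /Rintegral integral0.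
  apply: eq_Rintegral => x _.
  rewrite /core /far; have [?|xh] := leP h `|x + h|.
    by rewrite mulr1n mulr1 subrr mul0r.
  have [?|xh'] := leP h `|x - h|; first by rewrite mulr1n mulr1 subrr mulr0.
  move: xh xh'; rewrite !ltr_norml => /andP[? ?] /andP[? ?]; lra.
have -> : dot (fun x => f (x + h)) (fun x => f (x - h)) =
   dot (fun x => far h f (x + h)) (fun x => f (x - h)) +
   dot (fun x => core (x + h)) (fun x => far h f (x - h)).
  rewrite -[RHS]addr0 -core0 -addrA -dotDr; do ?exact: L2_shift.
  rewrite -[fun x => far h f (x - h) + _](_ : (fun x => f (x - h)) = _); last first.
    by rewrite {1}splitf.
  rewrite -dotDl; do ?exact: L2_shift.
  by congr dot; rewrite {1}splitf.
apply: (le_trans (ler_normD _ _)).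
have c1 := cauchy_schwarz (L2_shift h farL) (L2_shift (- h) fL).
have c2 := cauchy_schwarz (L2_shift h coreL) (L2_shift (- h) farL).
rewrite !L2norm_shift// in c1 c2.
have := ler_wpM2r (L2norm_ge0 (far h f)) core_le.
by move: c1 c2; rewrite -/core; lra.
Qed.

(** The length scale [h] is sent to infinity through the integers, which is
    enough for the limit in the energy inequality. *)
Lemma sdiff_norm_cvg f : L2 f ->
  dot (sdiff n%:R f) (sdiff n%:R f) @[n --> \oo] --> 2 * dot f f.
Proof.
move=> fL.
have -> : (fun n => dot (sdiff n%:R f) (sdiff n%:R f)) =
  (fun n => 2 * dot f f - 2 * dot (fun x => f (x + n%:R)) (fun x => f (x - n%:R))).
  by apply/funext => n; rewrite sdiff_norm.
rewrite -[X in _ --> X]subr0; apply: cvgB; first exact: cvg_cst.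
rewrite -[X in _ --> X](mulr0 (2:R)); apply: cvgM; first exact: cvg_cst.
apply: norm_cvg0.
apply: (@squeeze_cvgr _ _ _ _ (cst 0) (fun n => 2 * L2norm f * L2norm (far n%:R f))).
- by apply: nearW => n /=; rewrite normr_ge0 dot_translates_le.
- exact: cvg_cst.
- rewrite -[X in _ --> X](mulr0 (2 * L2norm f)); apply: cvgM; first exact: cvg_cst.
  exact: L2norm_far_cvg0.
Qed.

End far_translates.

(** * Derivatives on the half-line *)

Section halfline.
Context {R : realType}.
Implicit Types (F : R -> R) (l s t : R).

(** Unfolds the punctured one-sided filter into plain neighbourhoods of [t]. *)
Lemma halfline_quotientP F t l :
  (halfline_quotient F t s @[s --> within `[0, +oo[ t^'] --> l) <->
  forall e, 0 < e -> \forall s \near t, s != t -> 0 <= s ->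
    `|l - halfline_quotient F t s| < e.
Proof.
split=> [/cvgrPdist_lt H e e0|H].
  have {}H : \forall s \near t, s != t -> `[0, +oo[%classic s ->
    `|l - halfline_quotient F t s| < e := H e e0.
  by apply: filterS H => s Hs st s0; apply: Hs => //=; rewrite in_itv/= s0.
apply/cvgrPdist_lt => e e0.
suff : \forall s \near t, s != t -> `[0, +oo[%classic s ->
    `|l - halfline_quotient F t s| < e by [].
by apply: filterS (H e e0) => s Hs st /=; rewrite in_itv/= andbT; exact: Hs.
Qed.

Lemma halfline_quotient_is_derive F t l : 0 < t ->
  halfline_quotient F t s @[s --> within `[0, +oo[ t^'] --> l ->
  is_derive t 1 F l.
Proof.
move=> t0 /halfline_quotientP Fl.
have lim : h^-1 *: (F (h *: 1 + t) - F t) @[h --> (0 : R)^'] --> l.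
  apply/cvgrPdist_lt => e e0.
  have /nbhs0P core0 := Fl e e0.
  have /nbhs0P pos := lt_nbhsr t0.
  near=> h.
  have hn0 : h != 0 by near: h; exact: nbhs_dnbhs_neq.
  have th : t + h != t by rewrite addrC -subr_eq0 addrK.
  have th0 : 0 < t + h by near: h; exact: nbhs_dnbhs.
  have : t + h != t -> 0 <= t + h -> `|l - halfline_quotient F t (t + h)| < e.
    by near: h; exact: nbhs_dnbhs.
  move=> /(_ th (ltW th0)); rewrite /halfline_quotient.
  by rewrite /GRing.scale/= mulr1 addrAC subrr add0r (addrC h).
apply: DeriveDef; first by apply/cvg_ex; exists l.
exact/cvg_lim.
Unshelve. all: by end_near. Qed.

Lemma halfline_quotient_continuous F t l :
  halfline_quotient F t s @[s --> within `[0, +oo[ t^'] --> l ->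
  F s @[s --> within `[0, +oo[ (nbhs t)] --> F t.
Proof.
move=> /halfline_quotientP Fl; apply/cvgrPdist_lt => e e0.
have Fl1 := Fl 1 ltr01.
have c0 : 0 < `|l| + 1 by rewrite ltr_wpDl.
suff : \forall s \near t, `[0, +oo[%classic s -> `|F t - F s| < e by [].
near=> s => /=; rewrite in_itv/= andbT => s0.
have [->|st] := eqVneq s t; first by rewrite subrr normr0.
have : s != t -> 0 <= s -> `|l - halfline_quotient F t s| < 1 by near: s.
move=> /(_ st s0) lq.
have qle : `|halfline_quotient F t s| <= `|l| + 1.
  have := ler_normB l (l - halfline_quotient F t s).
  by rewrite opprB addrC subrK; lra.
have -> : F t - F s = - (halfline_quotient F t s * (s - t)).
  by rewrite /halfline_quotient mulrAC mulVf ?mul1r ?opprB// subr_eq0.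
rewrite normrN normrM.
apply: (@le_lt_trans _ _ ((`|l| + 1) * `|s - t|)); first exact: ler_wpM2r.
rewrite -ltr_pdivlMl// distrC.
near: s; apply: nbhsx_ballx; by rewrite mulr_gt0// invr_gt0.
Unshelve. all: by end_near. Qed.

Lemma halfline_nonincreasing (E dE : R -> R) t : 0 <= t ->
  (forall s, 0 <= s -> E r @[r --> within `[0, +oo[ (nbhs s)] --> E s) ->
  (forall s, 0 < s -> is_derive s 1 E (dE s)) ->
  (forall s, 0 < s -> dE s <= 0) -> E t <= E 0.
Proof.
move=> t0 Ec Ed dE0.
apply: (@ler0_derive1_le_cc R E 0 t) => //.
- by move=> s /[!in_itv]/= /andP[s0 _]; have := Ed s s0 => ?; exact: ex_derive.
- move=> s /[!in_itv]/= /andP[s0 _]; have := Ed s s0 => ?.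
  by rewrite derive1E derive_val; exact: dE0.
- apply/subspace_continuousP => s /=; rewrite in_itv/= => /andP[s0 _].
  apply: cvg_trans (Ec s s0); apply: cvg_app.
  apply: within_subset => r /=; rewrite !in_itv/= => /andP[-> _] //.
- by rewrite in_itv/= lexx t0.
- by rewrite in_itv/= lexx t0.
Qed.

End halfline.

(** * Differentiating squared norms along a curve *)

Section curves.
Context {R : realType}.
Implicit Types (U V : R -> R -> R) (T : (R -> R) -> R -> R) (s t C : R).

Lemma dot_sqrD (f g : R -> R) (c : R) : L2 f -> L2 g ->
  dot (fun x => f x + c * g x) (fun x => f x + c * g x) =
  dot f f + 2 * c * dot f g + c ^+ 2 * dot g g.
Proof.
move=> fL gL; have cgL := L2_scale c gL.
rewrite dotDl//; last exact: L2_add.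
by rewrite !dotDr// !dotZl// !dotZr// (dotC g f); ring.
Qed.

(** The product rule for ||T U||^2.  With r the error of the difference quotient
    of U, one has T U(s) = T U(t) + (s - t) (T V(t) + T r), and expanding the
    square leaves an error bounded by 2 |<T U(t), T r>| +
    |s - t| ||T V(t) + T r||^2, which tends to 0 with ||r||. *)
Lemma curve_derivative_dot T C U V t : 0 <= t -> 0 <= C ->
  (forall f, L2 f -> L2 (T f)) ->
  (forall f g, L2 f -> L2 g -> T (fun x => f x + g x) = (fun x => T f x + T g x)) ->
  (forall c f, L2 f -> T (fun x => c * f x) = (fun x => c * T f x)) ->
  (forall f, L2 f -> L2norm (T f) <= C * L2norm f) ->
  curve_derivative (@L2 R) (@L2norm R) U V ->
  halfline_quotient (fun s => dot (T (U s)) (T (U s))) t s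
    @[s --> within `[0, +oo[ t^'] --> 2 * dot (T (U t)) (T (V t)).
Proof.
move=> t0 C0 TL TD TZ TC UV.
have [UtL VtL lim] := UV t t0.
pose r s := fun x : R => (s - t)^-1 * (U s x - U t x) - V t x.
have rlim : L2norm (r s) @[s --> within `[0, +oo[ t^'] --> (0 : R) by exact: lim.
have stlim : `|s - t| @[s --> within `[0, +oo[ t^'] --> (0 : R).
  apply/cvgr0Pnorm_lt => e e0.
  suff : \forall s \near t, s != t -> `[0, +oo[%classic s -> `| `|s - t| | < e.
    by [].
  near=> s => _ _; rewrite normr_id distrC.
  by near: s; exact: nbhsx_ballx.
pose bd s := 2 * (L2norm (T (U t)) * (C * L2norm (r s))) +
  `|s - t| * (L2norm (T (V t)) + C * L2norm (r s)) ^+ 2.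
have bd0 : bd s @[s --> within `[0, +oo[ t^'] --> (0 : R).
  suff : bd s @[s --> within `[0, +oo[ t^'] -->
      2 * (L2norm (T (U t)) * (C * 0)) + 0 * (L2norm (T (V t)) + C * 0) ^+ 2.
    by rewrite !mulr0 mul0r addr0.
  have Crlim : C * L2norm (r s) @[s --> within `[0, +oo[ t^'] --> C * 0.
    by apply: cvgM; [exact: cvg_cst|exact: rlim].
  have TVrlim : L2norm (T (V t)) + C * L2norm (r s)
      @[s --> within `[0, +oo[ t^'] --> L2norm (T (V t)) + C * 0.
    by apply: cvgD; [exact: cvg_cst|exact: Crlim].
  apply: cvgD; last by apply: cvgM; [exact: stlim|apply: cvgM; exact: TVrlim].
  apply: cvgM; first exact: cvg_cst.
  by apply: cvgM; [exact: cvg_cst|exact: Crlim].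
apply/cvgrPdist_le => e e0.
move/cvgrPdist_le: bd0 => /(_ e e0) bde.
have {}bde : \forall s \near t, s != t -> `[0, +oo[%classic s ->
  `|0 - bd s| <= e := bde.
suff : \forall s \near t, s != t -> `[0, +oo[%classic s ->
  `|2 * dot (T (U t)) (T (V t)) -
    halfline_quotient (fun s => dot (T (U s)) (T (U s))) t s| <= e by [].
apply: filterS bde => s Hs st s0.
have {Hs} := Hs st s0; rewrite sub0r normrN => /(le_trans (ler_norm _)).
apply: le_trans.
have {}s0 : 0 <= s by move: s0 => /=; rewrite in_itv/= andbT.
have [UsL _ _] := UV s s0.
have stn0 : s - t != 0 by rewrite subr_eq0.
have rL : L2 (r s) by apply: L2_sub => //; apply: L2_scale; exact: L2_sub.
have UsE : U s = fun x => U t x + (s - t) * (V t x + r s x).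
  apply/funext => x; rewrite /r addrC [V t x + _]addrC subrK mulrA mulfV//.
  by rewrite mul1r subrK.
have VrL : L2 (fun x => V t x + r s x) by exact: L2_add.
have TUsE : T (U s) = fun x => T (U t) x + (s - t) * (T (V t) x + T (r s) x).
  rewrite UsE (TD (U t) (fun x => (s - t) * (V t x + r s x)))//; last first.
    exact: L2_scale.
  by rewrite (TZ (s - t) (fun x => V t x + r s x))// (TD (V t) (r s)).
have TUL := TL _ UtL; have TVL := TL _ VtL; have TrL := TL _ rL.
have TVrL : L2 (fun x => T (V t) x + T (r s) x) by exact: L2_add.
have quotE : 2 * dot (T (U t)) (T (V t)) -
    halfline_quotient (fun s => dot (T (U s)) (T (U s))) t s =
    - (2 * dot (T (U t)) (T (r s)) + (s - t) *
      dot (fun x => T (V t) x + T (r s) x) (fun x => T (V t) x + T (r s) x)).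
  rewrite /halfline_quotient TUsE.
  set W := fun x => T (V t) x + T (r s) x.
  have WE : dot (T (U t)) W = dot (T (U t)) (T (V t)) + dot (T (U t)) (T (r s)).
    exact: dotDr.
  by rewrite dot_sqrD// WE; field.
rewrite quotE normrN.
apply: (le_trans (ler_normD _ _)); rewrite /bd !normrM.
rewrite (@ger0_norm _ 2)//; apply: lerD.
  rewrite ler_pM2l//; apply: (le_trans (cauchy_schwarz TUL TrL)).
  by apply: ler_wpM2l; [exact: L2norm_ge0|exact: TC].
apply: ler_wpM2l => //; rewrite ger0_norm ?dot_ge0// -L2norm_sqr//.
rewrite lerXn2r ?nnegrE ?addr_ge0 ?mulr_ge0 ?L2norm_ge0//.
apply: (le_trans (L2norm_add TVL TrL)); rewrite lerD2l; exact: TC.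
Unshelve. all: by end_near. Qed.

End curves.

(** * The energy of a difference of the antiderivative *)

Section energy.
Context {R : realType}.
Local Notation mu := (@lebesgue_measure R).
Implicit Types (f g : R -> R) (h t s : R).

Lemma dot_ae_eq f g k : L2 f -> L2 g -> L2 k ->
  {ae mu, forall x, f x = g x} -> dot f k = dot g k.
Proof.
move=> fL gL kL fg; apply/eqP; rewrite -subr_eq0 -dotBl//; apply/eqP.
apply: dot_ae0 => //; first exact: L2_sub.
apply: filterS fg; first exact: (ae_filter_ringOfSetsType mu).
by move=> x ->; rewrite subrr.
Qed.

Lemma L2norm_ae_eq f g : L2 f -> L2 g ->
  {ae mu, forall x, f x = g x} -> L2norm f = L2norm g.
Proof.
move=> fL gL fg; rewrite !L2normE//; congr Num.sqrt.
by rewrite (dot_ae_eq fL gL fL fg) dotC (dot_ae_eq fL gL gL fg).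
Qed.

Lemma window_ae_eq h f g : 0 <= h -> L2 f -> L2 g ->
  {ae mu, forall x, f x = g x} -> window h f = window h g.
Proof.
move=> h0 fL gL fg; apply/funext => x; rewrite !windowE.
exact: (dot_ae_eq fL gL (L2_strip x h0) fg).
Qed.

(** The energy of w(x + h) - w(x - h) for w an antiderivative of u in x, divided
    by the square of the speed so that it decreases. *)
Definition energy (a : R -> R) (u ut : R -> R -> R) h t : R :=
  dot (window h (ut t)) (window h (ut t)) * (a t ^+ 2)^-1 +
  dot (sdiff h (u t)) (sdiff h (u t)).

Lemma curve_derivative_window h (U V : R -> R -> R) t : 0 <= t -> 0 <= h ->
  curve_derivative (@L2 R) (@L2norm R) U V ->
  halfline_quotient (fun s => dot (window h (U s)) (window h (U s))) t s
    @[s --> within `[0, +oo[ t^']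
    --> 2 * dot (window h (U t)) (window h (V t)).
Proof.
move=> t0 h0; apply: (curve_derivative_dot t0 (C := 2 * h)).
- by rewrite mulr_ge0.
- by move=> f; exact: L2_window.
- by move=> f g; exact: window_add.
- by move=> c f; exact: window_scale.
- by move=> f; exact: L2norm_window.
Qed.

Lemma curve_derivative_sdiff h (U V : R -> R -> R) t : 0 <= t ->
  curve_derivative (@L2 R) (@L2norm R) U V ->
  halfline_quotient (fun s => dot (sdiff h (U s)) (sdiff h (U s))) t s
    @[s --> within `[0, +oo[ t^']
    --> 2 * dot (sdiff h (U t)) (sdiff h (V t)).
Proof.
move=> t0; apply: (curve_derivative_dot t0 (C := 2)) => //.
- by move=> f; exact: L2_sdiff.
- by move=> f g _ _; apply/funext => x; rewrite /sdiff; ring.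
- by move=> c f _; apply/funext => x; rewrite /sdiff; ring.
- move=> f fL.
  have fhL := L2_shift h fL; have fhL' := L2_scale (-1) (L2_shift (- h) fL).
  have -> : sdiff h f = fun x => f (x + h) + -1 * f (x - h).
    by apply/funext => x; rewrite /sdiff mulN1r.
  apply: (le_trans (L2norm_add fhL fhL')).
  rewrite L2norm_shift// mulr_natl mulr2n lerD2l.
  rewrite L2normE// dotZl ?dotZr//; do ?exact: L2_shift.
  by rewrite mulrA mulN1r opprK mul1r -L2normE ?L2norm_shift//; exact: L2_shift.
Qed.

(** Since <S u_tt, S u_t> = a^2 <S u_xx, S u_t> = - a^2 <D u, D u_t>, the
    derivatives of the kinetic and potential terms cancel, except for the
    contribution - 2 a' ||S u_t||^2 / a^3 of the weight 1 / a^2. *)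
Lemma energy_nonincreasing (a : R -> R) (u ut utt : R -> R -> R) h t :
  0 <= h -> 0 <= t ->
  halfline_C1 a -> (forall t, 0 <= t -> 0 < a t) ->
  (forall t, 0 <= t -> 0 <= halfline_derive a t) ->
  curve_derivative (@L2 R) (@L2norm R) u ut ->
  curve_derivative (@L2 R) (@L2norm R) ut utt ->
  (forall t, 0 <= t -> Hsp 2 (u t)) ->
  (forall t, 0 < t -> {ae mu, forall x,
     utt t x - a t ^+ 2 * wderiv 2 (u t) x = 0}) ->
  energy a u ut h t <= energy a u ut h 0.
Proof.
move=> h0 t0 [aC1 _] apos ander du dut uH wave.
have da s : 0 <= s ->
    halfline_quotient a s r @[r --> within `[0, +oo[ s^'] --> halfline_derive a s.
  exact: aC1.
pose dE s := (2 * dot (window h (ut s)) (window h (utt s))) * (a s ^+ 2)^-1 -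
  dot (window h (ut s)) (window h (ut s)) * (2 * halfline_derive a s / a s ^+ 3)
  + 2 * dot (sdiff h (u s)) (sdiff h (ut s)).
apply: (@halfline_nonincreasing _ (energy a u ut h) dE) => //.
- move=> s s0; have as0 := apos s s0.
  apply: cvgD; last first.
    exact: (halfline_quotient_continuous (curve_derivative_sdiff (h := h) s0 du)).
  apply: cvgM.
    exact: (halfline_quotient_continuous (curve_derivative_window s0 h0 dut)).
  apply: cvgV; first by rewrite expf_neq0// gt_eqF.
  by apply: cvgM; exact: (halfline_quotient_continuous (da s s0)).
- move=> s s0; have as0 := apos s (ltW s0).
  have asn0 : a s != 0 by rewrite gt_eqF.
  have d1 := halfline_quotient_is_derive s0
    (curve_derivative_window (ltW s0) h0 dut).
  have d2 := halfline_quotient_is_derive s0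
    (curve_derivative_sdiff (h := h) (ltW s0) du).
  have d3 := halfline_quotient_is_derive s0 (da s (ltW s0)).
  have a2n0 : (fun r => a r ^+ 2) s != 0 by rewrite expf_neq0.
  have d33 : is_derive s 1 (fun r => a r ^+ 2) (a s * halfline_derive a s +
      a s * halfline_derive a s) := is_deriveM d3 d3.
  have d4 := @is_deriveV R (fun r => a r ^+ 2) s _ 1 a2n0 d33.
  have d5 := is_deriveD (is_deriveM d1 d4) d2.
  apply: (is_derive_eq d5); rewrite /dE /GRing.scale/=.
  by field.
- move=> s s0; have as0 := apos s (ltW s0).
  have [utL uttL _] := dut s (ltW s0); have [uL _ _] := du s (ltW s0).
  have [_ uH2] := uH s (ltW s0).
  have [gL gweak] := xgetPex (fun=> 0) (uH2 2%N isT).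
  have uttE : window h (utt s) = fun x => a s ^+ 2 * window h (wderiv 2 (u s)) x.
    rewrite -window_scale//; apply: window_ae_eq => //; first exact: L2_scale.
    apply: filterS (wave s s0); first exact: (ae_filter_ringOfSetsType mu).
    by move=> x /eqP; rewrite subr_eq0 => /eqP.
  rewrite /dE uttE dotZr//; do ?exact: L2_window.
  rewrite (dotC (window h (ut s)) (window h (wderiv 2 (u s)))).
  rewrite (weak_derivative2_window h0 uL gL utL gweak).
  set P := dot (window h (ut s)) _; set K := dot (sdiff h _) _.
  have -> : 2 * (a s ^+ 2 * - K) / a s ^+ 2 -
      P * (2 * halfline_derive a s / a s ^+ 3) + 2 * K =
      - (P * (2 * halfline_derive a s / a s ^+ 3)).
    by field; rewrite gt_eqF.
  rewrite oppr_le0 mulr_ge0 ?dot_ge0// mulr_ge0 ?invr_ge0 ?exprn_ge0 ?(ltW as0)//.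
  by rewrite mulr_ge0// ander// ltW.
Qed.

End energy.

Theorem theorem1p1 (R : realType) (a u0 u1 : R -> R) (u : R -> R -> R)
  (a_C1 : halfline_C1 a)
  (a_gt0 : forall t : R, 0 <= t -> 0 < a t)
  (a_bounded : (ereal_sup [set (a t)%:E | t in `[0%R, +oo[] < +oo)%E)
  (a_nondecreasing : forall t : R, 0 <= t -> 0 <= halfline_derive a t)
  (u0_test : test_function u0)
  (u1_test : test_function u1)
  (v1_L2 : L2 (primitive u1))
  (u_sol : strong_solution a u0 u1 u) :
  forall t : R, 0 <= t ->
    L2norm (u t) ^+ 2 <= I0 a u0 u1 ^+ 2 * a 0 ^- 2.
Proof.
move=> t t0; have [uH _ _ [ut [utt [du dut wave ae0 ae1]]]] := u_sol.
have a0 : 0 < a 0 by exact: a_gt0.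
have [utL _ _] := du t t0.
have [u0L ut0L _] := du 0 (lexx 0).
have u0tL := test_function_L2 u0_test; have u1tL := test_function_L2 u1_test.
pose v := primitive u1.
have bound n : dot (sdiff n%:R (u t)) (sdiff n%:R (u t)) <=
    dot (sdiff n%:R v) (sdiff n%:R v) * (a 0 ^+ 2)^-1 +
    dot (sdiff n%:R (u 0)) (sdiff n%:R (u 0)).
  have h0 : 0 <= n%:R :> R by [].
  have := energy_nonincreasing h0 t0 a_C1 a_gt0 a_nondecreasing du dut
    (fun s s0 => (uH s s0).1) wave.
  rewrite /energy (window_ae_eq h0 ut0L u1tL ae1).
  have -> : window n%:R u1 = sdiff n%:R v.
    apply/funext => x; apply: window_primitive => //.
    exact: test_function_integrable.
  apply: le_trans; rewrite lerDr mulr_ge0 ?dot_ge0// invr_ge0.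
  by rewrite exprn_ge0// ltW// a_gt0.
have lim : 2 * dot (u t) (u t) <=
    2 * dot v v * (a 0 ^+ 2)^-1 + 2 * dot (u 0) (u 0).
  apply: (ler_cvg_to (sdiff_norm_cvg utL) _ (nearW _ bound)).
  apply: cvgD; last exact: sdiff_norm_cvg.
  by apply: cvgM; [exact: sdiff_norm_cvg|exact: cvg_cst].
rewrite /I0 sqr_sqrtr; last by rewrite addr_ge0 ?sqr_ge0// mulr_ge0 ?sqr_ge0.
rewrite -(L2norm_ae_eq u0L u0tL ae0) !L2norm_sqr// -/v.
rewrite mulrDl mulrAC mulfV ?mul1r; last by rewrite expf_neq0// gt_eqF.
lra.
Qed.
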